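(* For every $\epsilon>0$, there exists $d_0$ such that if $\Delta$ is a real number with $\Delta\ge d_0$ and $G$ is a graph with maximum degree at most $\Delta$, then $(G,\mathcal{H})$ is fractionally properly conflict-free $(1+\epsilon)\Delta$-colorable for every hypergraph $\mathcal{H}$ with $V(\mathcal{H})=V(G)$ and $\mathrm{rank}(\mathcal{H})\le\Delta$.
   Context: Graphs and hypergraphs are finite, graphs are simple, and every edge of a hypergraph is a nonempty set of vertices (the edge set may be empty). $\mathrm{rank}(\mathcal{H})=\max_{f\in E(\mathcal{H})}|f|$ (with value $0$ if there are no edges). Write $[k]=\{1,\dots,k\}$. For positive integers $a,b$, an $(a:b)$-coloring $\varphi$ of a graph or hypergraph assigns to each vertex a $b$-element subset of $[a]$; for $j\in[a]$, $\varphi^{-1}(j)$ denotes the set of vertices $v$ with $j\in\varphi(v)$. An $(a:b)$-coloring of $G$ is proper if $\varphi^{-1}(j)$ is a stable (independent) set of $G$ for every $j\in[a]$. An $(a:b)$-coloring of $\mathcal{H}$ is conflict-free if for every edge $z$ of $\mathcal{H}$ there exist at least $b$ elements $\ell\in[a]$ with $|z\cap\varphi^{-1}(\ell)|=1$. An $(a:b)$-coloring of $(G,\mathcal{H})$ is (fractionally) proper conflict-free if it is a proper $(a:b)$-coloring of $G$ and a conflict-free $(a:b)$-coloring of $\mathcal{H}$. For a positive real $t$, $(G,\mathcal{H})$ is fractionally properly conflict-free $t$-colorable if there exists a proper conflict-free $(x:y)$-coloring of $(G,\mathcal{H})$ for some positive integers $x,y$ with $x/y\le t$. *)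

(* Defs.v *)
From HB Require Import structures.
From mathcomp Require Import all_boot all_order all_algebra.
From mathcomp Require Import reals.

Set Implicit Arguments.
Unset Strict Implicit.
Unset Printing Implicit Defensive.

Import Order.TTheory GRing.Theory Num.Theory.
Local Open Scope ring_scope.

Record graph := Graph {
  vertex :> finType;
  adj : rel vertex;
  adj_sym : symmetric adj;
  adj_irrefl : irreflexive adj }.

Definition degree (G : graph) (v : G) : nat := #|[set u | adj v u]|.

Definition max_degree (G : graph) : nat := \max_(v : G) degree v.

Definition stable (G : graph) (S : {set G}) : Prop :=
  forall u v : G, u \in S -> v \in S -> ~~ adj u v.

Record hypergraph (V : finType) := Hypergraph {
  hedges : {set {set V}};
  hedges_neq0 : set0 \notin hedges }.

Definition hrank (V : finType) (H : hypergraph V) : nat :=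
  \max_(f in hedges H) #|f|.

(* The palette {1, ..., a} is encoded as 'I_a. *)
Definition coloring (V : finType) (a b : nat) (phi : V -> {set 'I_a}) : Prop :=
  forall v, #|phi v| = b.

Definition color_class (V : finType) (a : nat) (phi : V -> {set 'I_a})
  (j : 'I_a) : {set V} := [set v | j \in phi v].

Definition proper_coloring (G : graph) (a b : nat) (phi : G -> {set 'I_a}) :
  Prop := coloring b phi /\ forall j : 'I_a, stable (color_class phi j).

Definition conflict_free_coloring (V : finType) (H : hypergraph V) (a b : nat)
  (phi : V -> {set 'I_a}) : Prop :=
  coloring b phi /\
  forall z, z \in hedges H ->
    (b <= #|[set l : 'I_a | #|z :&: color_class phi l| == 1%N]|)%N.

Definition proper_conflict_free_coloring (G : graph) (H : hypergraph G)
  (a b : nat) (phi : G -> {set 'I_a}) : Prop :=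
  proper_coloring b phi /\ conflict_free_coloring H b phi.

Definition frac_pcf_colorable (R : realType) (G : graph) (H : hypergraph G)
  (t : R) : Prop :=
  exists x y : nat, [/\ (0 < x)%N, (0 < y)%N, x%:R / y%:R <= t &
    exists phi : G -> {set 'I_x}, proper_conflict_free_coloring H y phi].

(* Main.v *)
Require Import Defs.
From mathcomp Require Import all_boot all_order all_algebra.
From mathcomp Require Import reals.
From mathcomp Require Import zify lra.

(** Fix q colors and let P be the set of all proper q-colorings of G.  Giving
    every member of P its own private copy of the q colors turns P into one
    proper (#|P| q : #|P|)-coloring of G, whose ratio is q.  It is conflict-free
    as soon as, for every hyperedge z, the average over P of the number of
    colors occurring exactly once on z is at least 1
    ([frac_pcf_colorable_of_average]).

    That average is bounded below by resampling one vertex at a time.  If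
    q >= max_degree G + m, then, whatever the colors of the other vertices, a
    vertex u of a uniformly random member of P takes a given color c with
    probability at most 1 / m ([recolor_bound]).  Revealing one after another
    the vertices of z other than v, the color of v is missed by all of them
    with probability at least (1 - 1/m)^(#|z| - 1) ([avoid_bound]), so the
    average is at least k (1 - 1/m)^(k - 1) with k = #|z|
    ([unique_colors_average]).

    With m close to eps Delta and 1 <= k <= Delta, this quantity is at least 1:
    for k <= m by Bernoulli's inequality, and for larger k because
    (1 - 1/m)^(k - 1) is bounded below by a constant depending on eps only,
    while k > m is large ([expected_unique_ge1]). *)

Set Implicit Arguments.
Unset Strict Implicit.
Unset Printing Implicit Defensive.

Import Order.TTheory GRing.Theory Num.Theory.

(** * The numerical estimate *)

Lemma bernoulli_nat (m j : nat) :
  0 < m -> m ^ j * m <= m.-1 ^ j * m + j * m ^ j.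
Proof.
case: m => // m _ /=; elim: j => [|j IH]; first by rewrite !expn0; lia.
have le_pow : m ^ j <= m.+1 ^ j by case: j {IH} => // j; rewrite leq_exp2r.
rewrite !expnS; nia.
Qed.

(** In terms of m = 2h, this says k (1 - 1/m)^(k - 1) >= 1.  Choosing m even
    gives (1 - 1/m)^h >= 1/2 by Bernoulli's inequality, hence
    (1 - 1/m)^(k - 1) >= 2^-M, which the factor k > m >= 2^M absorbs. *)
Lemma expected_unique_ge1 (h M k : nat) :
  0 < h -> 0 < k -> k <= M * h -> 2 ^ M <= h.*2 ->
  h.*2 ^ k.-1 <= k * h.*2.-1 ^ k.-1.
Proof.
move=> h_gt0 k_gt0 le_k_Mh le_2M; set m := h.*2.
have m_gt0 : 0 < m by rewrite double_gt0.
case: (leqP k m) => [le_km | lt_mk].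
  (* Bernoulli reduces this to k (m - (k - 1)) >= m, that is
     (k - 1) (m - k) >= 0. *)
  have := bernoulli_nat k.-1 m_gt0.
  set a := m ^ _; set b := m.-1 ^ _ => ber.
  rewrite -(leq_pmul2r m_gt0).
  have : k * (m - k.-1) >= m by nia.
  have : a * (m - k.-1) <= b * m by rewrite mulnBr; nia.
  nia.
(* Bernoulli's inequality: (1 - 1/m)^h >= 1 - h/m = 1/2. *)
have half : m ^ h <= 2 * m.-1 ^ h.
  have := bernoulli_nat h m_gt0; rewrite /m; set a := _ ^ h; set b := _ ^ h.
  by nia.
have pow : m ^ (h * M) <= 2 ^ M * m.-1 ^ (h * M).
  rewrite !expnM -expnMn.
  by case: (M) => // M'; rewrite leq_exp2r.
have kE : h * M = k.-1 + (h * M - k.-1) by lia.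
have pred_gt0 : 0 < m.-1 by lia.
have le_pow : m.-1 ^ (h * M - k.-1) <= m ^ (h * M - k.-1).
  by case: (_ - _) => // j; rewrite leq_exp2r //; lia.
rewrite -(@leq_pmul2r (m ^ (h * M - k.-1))) ?expn_gt0 ?m_gt0 //.
rewrite -expnD -kE; apply: leq_trans pow _.
rewrite {1}kE expnD mulnA; apply: leq_mul => //; apply: leq_mul => //.
by apply: leq_trans le_2M _; apply: ltnW.
Qed.

(** * Proper colorings and recoloring *)

Section ProperColorings.
Variables (G : graph) (q : nat).
Implicit Types (f : {ffun G -> 'I_q}) (u v w : G) (c d : 'I_q) (z : {set G}).

Definition proper_colorings : {set {ffun G -> 'I_q}} :=
  [set f : {ffun G -> 'I_q} | [forall u, forall v, adj u v ==> (f u != f v)]].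

Definition recolor f u c : {ffun G -> 'I_q} :=
  [ffun w => if w == u then c else f w].

Definition available f u : {set 'I_q} := ~: (f @: [set w | adj u w]).

Lemma proper_coloringsP f :
  reflect (forall u v, adj u v -> f u != f v) (f \in proper_colorings).
Proof.
rewrite inE; apply: (iffP forallP) => [pf u v | pf u].
  by move/forallP: (pf u) => /(_ v) /implyP.
by apply/forallP => v; apply/implyP; apply: pf.
Qed.

Lemma card_available m f u :
  max_degree G + m <= q -> m <= #|available f u|.
Proof.
move=> le_q; rewrite cardsCs setCK card_ord.
have le_deg : #|f @: [set w | adj u w]| <= max_degree G.
  by apply: leq_trans (leq_imset_card _ _) _; apply: leq_bigmax.
apply: leq_trans (leq_sub2l q le_deg).
by rewrite leq_subRL // (leq_trans (leq_addr m _)).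
Qed.

Lemma availableP f u c w : c \in available f u -> adj u w -> c != f w.
Proof.
rewrite inE => cN uw; apply: contraNneq cN => ->.
by apply: imset_f; rewrite inE.
Qed.

Lemma recolor_proper f u c :
  f \in proper_colorings -> c \in available f u ->
  recolor f u c \in proper_colorings.
Proof.
move=> /proper_coloringsP pf cA; apply/proper_coloringsP => w1 w2 e12.
rewrite !ffunE; case: (eqVneq w1 u) (eqVneq w2 u) e12.
- by move=> -> [-> | _ uw2]; [rewrite adj_irrefl | apply: availableP uw2].
- move=> _ [-> e1u | _]; last exact: pf.
  by rewrite eq_sym; apply: availableP cA _; rewrite adj_sym.
Qed.

Lemma exists_proper_coloring :
  max_degree G < q -> 0 < #|proper_colorings|.
Proof.
move=> lt_q.
have [f pf] : exists f : {ffun G -> 'I_q},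
    {in enum G &, forall u v, adj u v -> f u != f v}.
  elim: (enum G) => [|w s [f pf]].
    by exists [ffun=> Ordinal (leq_ltn_trans (leq0n _) lt_q)].
  have /card_gt0P [c cA] : 0 < #|available f w|.
    by apply: card_available; rewrite addn1.
  exists (recolor f w c) => u v; rewrite !inE !ffunE.
  case: (eqVneq u w) (eqVneq v w).
  - move=> -> [-> | _ _ _ wv]; first by rewrite adj_irrefl.
    exact: availableP wv.
  - move=> _ [-> _ _ uw | _ /= us vs]; last exact: pf.
    by rewrite eq_sym; apply: availableP cA _; rewrite adj_sym.
apply/card_gt0P; exists f; apply/proper_coloringsP => u v.
by apply: pf; rewrite mem_enum.
Qed.

(** Each member of A with color c at u can be recolored at u in at least m
    ways inside A, and the result determines both the original coloring
    (put c back at u) and the new color. *)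
Lemma recolor_bound m (A : {set {ffun G -> 'I_q}}) u c :
  max_degree G + m <= q -> A \subset proper_colorings ->
  (forall f d, f \in A -> recolor f u d \in proper_colorings ->
     recolor f u d \in A) ->
  m * #|[set f in A | f u == c]| <= #|A|.
Proof.
move=> le_q /subsetP sAP closed_A; set B := [set f in A | _].
pose D := [set p : {ffun G -> 'I_q} * 'I_q |
  (p.1 \in B) && (p.2 \in available p.1 u)].
have cardD : #|D| = \sum_(f in B) #|available f u|.
  rewrite -sum1_card; under [RHS]eq_bigr do rewrite -sum1_card.
  by rewrite pair_big_dep /=; apply: eq_bigl => p; rewrite inE.
have le_mD : m * #|B| <= #|D|.
  rewrite cardD mulnC -sum_nat_const; apply: leq_sum => f _.
  exact: card_available.
apply: leq_trans le_mD _.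
rewrite -(@card_in_imset _ _ (fun p => recolor p.1 u p.2)).
  apply/subset_leq_card/subsetP => g /imsetP [[f d]] /=.
  rewrite !inE /= => /andP [/andP [fA _] dA] ->.
  by apply: closed_A => //; apply: recolor_proper; rewrite ?sAP // inE.
move=> [f d] [g e] /=; rewrite !inE /= => /andP [/andP [_ /eqP fu] _].
move=> /andP [/andP [_ /eqP gu] _] /ffunP eqfg; congr pair.
  apply/ffunP => w; have := eqfg w; rewrite !ffunE.
  by case: eqVneq => // ->; rewrite fu gu.
by have := eqfg u; rewrite !ffunE eqxx.
Qed.

(** The vertices of s are revealed one at a time: avoiding c on the earlier
    ones, or having it at v, puts no restriction on the next vertex, so
    [recolor_bound] applies at each step and costs a factor 1 - 1/m. *)
Lemma avoid_bound m v c (s : seq G) :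
  max_degree G + m <= q -> uniq (v :: s) ->
  m.-1 ^ size s * #|[set f in proper_colorings | f v == c]| <=
  m ^ size s *
    #|[set f in proper_colorings | (f v == c) && all (fun u => f u != c) s]|.
Proof.
move=> le_q; elim: s => [_ | u s IH].
  rewrite !expn0 !mul1n; apply/subset_leq_card/subsetP => f.
  by rewrite !inE => /= /andP [-> ->].
rewrite /= inE negb_or => /and3P [/andP [neq_vu vs] us uniq_s].
set P0 := #|[set f in proper_colorings | f v == c]| in IH *.
set A := [set f in _ | _] in IH.
have {}IH : m.-1 ^ size s * P0 <= m ^ size s * #|A| by apply: IH; rewrite /= vs.
set A' := [set f in _ | _].
have leB : m * #|[set f in A | f u == c]| <= #|A|.
  apply: recolor_bound => //.
    by apply/subsetP => f; rewrite inE => /andP [].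
  move=> f d; rewrite [f \in A]inE => /and3P [_ fv fs] pf.
  rewrite inE pf ffunE (negbTE neq_vu) fv /=.
  apply/allP => w ws; rewrite ffunE.
  have /negbTE -> : w != u by apply: contraNneq us => <-.
  exact: (allP fs).
have splitA : #|A| = #|[set f in A | f u == c]| + #|A'|.
  rewrite -(cardsID [set f : {ffun G -> 'I_q} | f u == c] A).
  congr (_ + _); apply: eq_card => f.
    by rewrite !inE.
  by rewrite !in_set /= andbCA; congr (_ && _); rewrite andbCA.
have step : m.-1 * #|A| <= m * #|A'|.
  by case: (m) leB => // m'; rewrite splitA /=; nia.
rewrite !expnS.
have le1 : m.-1 * (m.-1 ^ size s * P0) <= m.-1 * (m ^ size s * #|A|).
  by rewrite leq_mul2l IH orbT.
have le2 : m ^ size s * (m.-1 * #|A|) <= m ^ size s * (m * #|A'|).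
  by rewrite leq_mul2l step orbT.
rewrite -mulnA; apply: leq_trans le1 _; rewrite mulnCA.
by apply: leq_trans le2 _; rewrite mulnCA mulnA.
Qed.

(** * Colors occurring exactly once *)

Definition unique_vertices f z : {set G} :=
  [set v in z | [forall u in z :\ v, f u != f v]].

Definition unique_colors f z : {set 'I_q} :=
  [set c | #|[set v in z | f v == c]| == 1].

Lemma card_unique_vertices f z :
  #|unique_vertices f z| <= #|unique_colors f z|.
Proof.
have uniqP v w : v \in unique_vertices f z -> w \in z -> f w = f v -> w = v.
  rewrite inE => /andP [_ /forall_inP uv] wz fwv; apply/eqP.
  by apply: contraT => neq; have := uv w; rewrite !inE neq wz fwv eqxx => /(_ isT).
rewrite -(@card_in_imset _ _ f); last first.
  move=> v w vU wU fvw; apply: uniqP wU _ fvw.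
  by move: vU; rewrite inE => /andP [].
apply/subset_leq_card/subsetP => c /imsetP [v vU ->]; rewrite inE.
apply/cards1P; exists v; apply/setP => w; rewrite !inE.
apply/andP/eqP => [[wz /eqP fwv] | ->]; first exact: uniqP fwv.
by move: vU; rewrite inE => /andP [->].
Qed.

(** In terms of averages, the bound is k (1 - 1/m)^(k - 1) with k = #|z|:
    by [avoid_bound], summed over the color c of v, every vertex v of z is the
    only one of its color in z with probability at least (1 - 1/m)^(k - 1),
    and distinct such vertices have distinct unique colors. *)
Lemma unique_colors_average m z :
  max_degree G + m <= q ->
  #|z| * m.-1 ^ #|z|.-1 * #|proper_colorings| <=
  m ^ #|z|.-1 * \sum_(f in proper_colorings) #|unique_colors f z|.
Proof.
move=> le_q.
have vertex_bound v : v \in z ->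
    m.-1 ^ #|z|.-1 * #|proper_colorings| <=
    m ^ #|z|.-1 * #|[set f in proper_colorings | v \in unique_vertices f z]|.
  move=> vz; pose s := enum (z :\ v).
  have sizes : size s = #|z|.-1 by rewrite -cardE (cardsD1 v z) vz.
  have uniq_vs : uniq (v :: s).
    by rewrite /= enum_uniq mem_enum !inE eqxx.
  have split_color (Q : {set {ffun G -> 'I_q}}) :
      #|Q| = \sum_c #|[set f in Q | f v == c]|.
    rewrite -sum1_card (partition_big (fun f => f v) xpredT) //=.
    by apply: eq_bigr => c _; rewrite -sum1_card; apply: eq_bigl => f; rewrite inE.
  rewrite (split_color proper_colorings) [X in _ <= _ * X]split_color !big_distrr /=.
  apply: leq_sum => c _; rewrite -sizes.
  apply: leq_trans (avoid_bound c le_q uniq_vs) _.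
  rewrite leq_mul2l; apply/orP; right.
  apply/subset_leq_card/subsetP => f; rewrite inE => /and3P [pf fv /allP fs].
  rewrite inE fv andbT inE pf inE vz /=; apply/forall_inP => u uz.
  by rewrite (eqP fv); apply: fs; rewrite mem_enum.
have sum_vertices :
    #|z| * (m.-1 ^ #|z|.-1 * #|proper_colorings|) <=
    \sum_(v in z) m ^ #|z|.-1 *
      #|[set f in proper_colorings | v \in unique_vertices f z]|.
  by rewrite -sum_nat_const; apply: leq_sum.
rewrite -mulnA; apply: leq_trans sum_vertices _.
have swap : \sum_(v in z) #|[set f in proper_colorings | v \in unique_vertices f z]|
    = \sum_(f in proper_colorings) #|unique_vertices f z|.
  under eq_bigr do rewrite -sum1dep_card.
  rewrite (exchange_big_dep (mem proper_colorings)) /=; last by move=> v f _ /andP [].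
  apply: eq_bigr => f pf; rewrite -sum1_card.
  by apply: eq_bigl => v; rewrite pf !inE; case: (v \in z).
rewrite -big_distrr /= leq_mul2l swap; apply/orP; right.
by apply: leq_sum => f _; apply: card_unique_vertices.
Qed.

End ProperColorings.

(** * From an average over proper colorings to a fractional coloring *)

(** Colors of the fractional coloring are pairs of a proper coloring f and a
    color c, transported to an ordinal by enumeration; a vertex v receives the
    pairs (f, f v). *)
Lemma frac_pcf_colorable_of_average (R : realType) (G : graph)
    (H : hypergraph G) (q : nat) (t : R) :
  0 < q -> 0 < #|proper_colorings G q| -> (q%:R <= t)%R ->
  (forall z, z \in hedges H ->
    #|proper_colorings G q| <=
      \sum_(f in proper_colorings G q) #|unique_colors f z|) ->
  frac_pcf_colorable H t.
Proof.
move=> q_gt0 P_gt0 le_qt average.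
set P := proper_colorings G q in P_gt0 average *.
pose T : finType := ({f | f \in P} * 'I_q)%type.
have cardT : #|T| = #|P| * q by rewrite card_prod card_sig card_ord.
exists #|T|, #|P|; split => //.
- by rewrite cardT muln_gt0 P_gt0.
- have nz : (#|P|%:R != 0 :> R)%R by rewrite pnatr_eq0 -lt0n.
  by rewrite cardT natrM mulrAC mulfV // mul1r.
pose dec (l : 'I_#|T|) : T := enum_val l.
pose enc (p : T) : 'I_#|T| := enum_rank p.
have encK : cancel enc dec by exact: enum_rankK.
have decK : cancel dec enc by exact: enum_valK.
pose phi (v : G) : {set 'I_#|T|} := [set l | val (dec l).1 v == (dec l).2].
have mem_phi l v : (l \in phi v) = (val (dec l).1 v == (dec l).2) by rewrite inE.
have phi_coloring : coloring #|P| phi.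
  move=> v; have -> : phi v = [set enc (f, val f v) | f : {f | f \in P}].
    apply/setP => l; rewrite mem_phi; apply/eqP/imsetP => [e | [f _ ->]].
      by exists (dec l).1; rewrite // e -surjective_pairing decK.
    by rewrite encK.
  by rewrite card_imset ?cardsT ?card_sig // => f g /(can_inj encK) [].
exists phi; split; split => //.
- move=> l u v; rewrite !inE => /eqP eu /eqP ev.
  have /proper_coloringsP pf := valP (dec l).1.
  by apply: contraTN isT => /pf; rewrite eu ev eqxx.
move=> z zH; apply: leq_trans (average z zH) _.
set L := [set l | _].
have mem_L l : (l \in L) = ((dec l).2 \in unique_colors (val (dec l).1) z).
  by rewrite !inE; congr (_ == _); apply: eq_card => v; rewrite !inE.
have cardL : #|L| = #|[set p : T | p.2 \in unique_colors (val p.1) z]|.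
  rewrite -(card_imset _ (can_inj decK)); apply: eq_card => p.
  rewrite [RHS]inE; apply/imsetP/idP => [[l lL ->] | pU]; first by rewrite -mem_L.
  by exists (enc p); rewrite ?mem_L encK.
rewrite cardL (big_sub P (fun f => #|unique_colors f z|)) -sum1dep_card.
rewrite -(pair_big_dep xpredT (fun f : {f | f \in P} => mem (unique_colors (val f) z))
  (fun _ _ => 1)) /=.
by apply: leq_sum => f _; rewrite sum1_card.
Qed.

Local Open Scope ring_scope.

Theorem theorem7 (R : realType) (eps : R) (heps : 0 < eps) :
  exists d0 : R, forall (Delta : R) (G : graph),
    d0 <= Delta -> (max_degree G)%:R <= Delta ->
    forall H : hypergraph G, (hrank H)%:R <= Delta ->
      frac_pcf_colorable H ((1 + eps) * Delta).
Proof.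
(* M is such that k <= Delta implies k <= M * h, and the bound on Delta makes
   2 ^ M <= 2 * h, as [expected_unique_ge1] requires. *)
pose M := (Num.truncn (4 / eps)).+1.
have lt_M : 4 / eps < M%:R by rewrite truncnS_gt.
exists ((4 + 2 * (2 ^ M)%:R) / eps) => Delta G.
rewrite ler_pdivrMr // => le_Delta le_deg H le_rank.
have pow_ge0 : 0 <= (2 ^ M)%:R :> R by rewrite ler0n.
(* Since 2 * h <= eps * Delta, the number max_degree G + 2 * h of colors is at
   most (1 + eps) * Delta, and every vertex has at least 2 * h available ones. *)
pose h := Num.truncn (eps * Delta / 2).
have /andP [le_h lt_h] : h%:R <= eps * Delta / 2 < h.+1%:R.
  by apply: truncn_itv; lra.
rewrite -[h.+1%:R]natr1 in lt_h.
have h_gt0 : (0 < h)%N by rewrite -(ltr0n R); lra.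
have le_2M : (2 ^ M <= h.*2)%N by rewrite -(ler_nat R) -muln2 natrM; lra.
(* Since eps * Delta >= 4, rounding down loses at most a factor 2. *)
have le_DeltaMh : Delta <= (M * h)%:R.
  have le4 : eps * Delta <= 4 * h%:R by lra.
  have -> : Delta = eps * Delta / eps by rewrite mulrAC mulfV ?mul1r // gt_eqF.
  rewrite ler_pdivrMr // natrM; apply: le_trans le4 _.
  rewrite mulrAC ler_wpM2r ?ler0n //.
  by rewrite -ler_pdivrMr // ltW.
have lt_deg : (max_degree G < max_degree G + h.*2)%N.
  by rewrite -[X in (X < _)%N]addn0 ltn_add2l double_gt0.
apply: (@frac_pcf_colorable_of_average R G H (max_degree G + h.*2)).
- exact: leq_ltn_trans lt_deg.
- exact: exists_proper_coloring.
- by rewrite natrD -muln2 natrM; lra.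
move=> z zH.
have z_gt0 : (0 < #|z|)%N.
  by rewrite card_gt0; apply: contraTneq zH => ->; apply: hedges_neq0.
have le_zMh : (#|z| <= M * h)%N.
  rewrite -(ler_nat R); apply: le_trans le_DeltaMh; apply: le_trans le_rank.
  by rewrite ler_nat; apply: leq_bigmax_cond.
have average := unique_colors_average z (leqnn (max_degree G + h.*2)).
have ge1 := expected_unique_ge1 h_gt0 z_gt0 le_zMh le_2M.
rewrite -(@leq_pmul2l (h.*2 ^ #|z|.-1)) ?expn_gt0 ?double_gt0 ?h_gt0 //.
by apply: leq_trans average; rewrite leq_mul2r ge1 orbT.
Qed.
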